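(* Let $\mathcal{F}$ be the family of all strictly increasing and continuous distribution functions on $\mathbb{R}$, and for each $F\in\mathcal{F}$ let $p_F$ be the Borel probability measure on $\mathbb{R}$ defined by $F$. Then there exists a well-founded estimate of an unknown distribution function $F$ $(F\in\mathcal{F})$ for the family of Borel probability measures $\{p_F^{\mathbb{N}} : F\in\mathcal{F}\}$ on $\mathbb{R}^{\mathbb{N}}$.
   Context: $\mathbb{R}^{\mathbb{N}}$ is the space of all real sequences with the product topology and its Borel $\sigma$-algebra. A Borel probability measure $p$ on $\mathbb{R}$ is defined by the distribution function $F$ if $p((-\infty,x])=F(x)$ for all $x\in\mathbb{R}$. $p^{\mathbb{N}}$ denotes the product of countably many copies of $p$. Let $\{\mu_i : i\in I\}$ be a family of probability measures on a measurable space $(X,M)$. Let $\overline{\mu}_i$ denote the usual completion of $\mu_i$, let $\mathrm{dom}(\overline{\mu}_i)$ be the $\sigma$-algebra on which it is defined, and let $S(X)=\bigcap_{i\in I}\mathrm{dom}(\overline{\mu}_i)$. Let $S(I)$ be the smallest $\sigma$-algebra of subsets of $I$ containing all singletons. An $(S(X),S(I))$-measurable map $T:X\to I$ is called a well-founded estimate of an unknown parameter $i$ $(i\in I)$ for the family $\{\mu_i : i\in I\}$ if $\overline{\mu}_i(T^{-1}(\{i\}))=1$ for every $i\in I$. In the claim, $X=\mathbb{R}^{\mathbb{N}}$ and $I=\mathcal{F}$. *)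

(* Defs.v *)
From HB Require Import structures.
From mathcomp Require Import all_boot all_order all_algebra.
From mathcomp Require Import all_classical all_reals all_analysis.
From mathcomp Require Import measurable_realfun.
Import Order.TTheory GRing.Theory Num.Theory.
Import numFieldNormedType.Exports.

Set Implicit Arguments.
Unset Strict Implicit.
Unset Printing Implicit Defensive.

Local Open Scope classical_set_scope.
Local Open Scope ring_scope.
Local Open Scope ereal_scope.

Section completion.
Context d (X : measurableType d) (R : realType) (mu : {measure set X -> \bar R}).

(* The completion is carried by the sigma-algebra [completed_algebra_gen mu] of
   the sets B `|` N with B measurable and N negligible, where its value is mu B.
   Elsewhere the value below is meaningless. *)
Definition completion (A : set X) : \bar R :=
  mu (xget set0 [set B | measurable B /\
                         exists2 N, mu.-negligible N & B `|` N = A]).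

Lemma completionE (B N : set X) :
  measurable B -> mu.-negligible N -> completion (B `|` N) = mu B.
Proof.
move=> mB nN; rewrite /completion; case: xgetP => [C _ [mC [M nM CM]]|].
  have sub (P Q K : set X) : measurable P -> measurable Q ->
      mu.-negligible K -> P `<=` Q `|` K -> mu P <= mu Q.
    move=> mP mQ [K' [mK' K'0 KK']] PQ.
    rewrite -[leRHS]adde0 -K'0.
    apply: (le_trans (le_measure _ _ _ (_ : P `<=` Q `|` K'))).
    - by rewrite inE.
    - by rewrite inE; exact: measurableU.
    - by apply: (subset_trans PQ); exact: setUS.
    - exact: measureU2.
  by apply/eqP; rewrite eq_le (sub C B N)//= ?(sub B C M)// ?CM // -CM;
    exact: subsetUl.
by move=> /(_ B) []; split => //; exists N.
Qed.

End completion.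

Section well_founded_estimate.
Context d (X : measurableType d) (R : realType) (I : Type).
Variable mu : I -> probability X R.

Definition common_completed_algebra : set (set X) :=
  \bigcap_i completed_algebra_gen (mu i).

Definition singleton_algebra : set (set I) := <<s @singletons I >>.

Definition well_founded_estimate (T : X -> I) : Prop :=
  (forall J, singleton_algebra J -> common_completed_algebra (T @^-1` J)) /\
  (forall i, completion (mu i) (T @^-1` [set i]) = 1).

End well_founded_estimate.

(* Real sequences with the Borel sigma-algebra of the product topology. *)
Definition seqR (R : realType) := g_sigma_algebraType (@open {ptws nat -> R}).

Section countable_power.
Context (R : realType) (p : probability (measurableTypeR R) R).

Definition is_countable_power (P : probability (seqR R) R) : Prop :=
  forall (n : nat) (A : nat -> set (measurableTypeR R)),
    (forall k, measurable (A k)) ->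
    P [set x | forall k, (k < n)%N -> A k (x k)] = \prod_(k < n) p (A k).

(* By Kolmogorov's extension theorem and the pi-lambda theorem there is exactly
   one measure as above, so the default value of [get] plays no role. *)
Definition countable_power : probability (seqR R) R := get is_countable_power.

End countable_power.

(* [cumulativeBounded 0 1] is the type of distribution functions on R:
   nondecreasing, right-continuous, with limits 0 at -oo and 1 at +oo. *)
Definition sc_distribution (R : realType) : Type :=
  {F : cumulativeBounded (0 : R) (1 : R) |
    {homo F : x y / (x < y)%R} /\ continuous F}.

(* Indexing by this type is indexing by functions: no function is repeated. *)
Lemma sc_distribution_inj (R : realType) (F G : sc_distribution R) :
  (sval F : R -> R) = sval G -> F = G.
Proof.
move: F G => [F HF] [G HG] /= FG; apply: eq_exist => {HF HG}.
case: F G FG => [f [[f1 f2] [f3 f4]]] [g [[g1 g2] [g3 g4]]] /= fg.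
case: _ / fg in g1 g2 g3 g4 *.
by rewrite (Prop_irrelevance f1 g1) (Prop_irrelevance f2 g2)
  (Prop_irrelevance f3 g3) (Prop_irrelevance f4 g4).
Qed.

Definition measure_of (R : realType) (F : sc_distribution R) :
    probability (measurableTypeR R) R :=
  lebesgue_stieltjes_measure (sval F).

Lemma measure_ofE (R : realType) (F : sc_distribution R) (x : R) :
  measure_of F `]-oo, x]%classic = (sval F x)%:E.
Proof. exact: (cdf_lebesgue_stieltjes_id (sval F)). Qed.

(* Main.v *)
From HB Require Import structures.
Require Import Defs.
From mathcomp Require Import all_boot all_order all_algebra.
From mathcomp Require Import all_classical all_reals all_analysis.
From mathcomp Require Import measurable_realfun lra ring.
Import Order.TTheory GRing.Theory Num.Theory.
Import numFieldNormedType.Exports.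

Set Implicit Arguments.
Unset Strict Implicit.
Unset Printing Implicit Defensive.

Local Open Scope classical_set_scope.
Local Open Scope ring_scope.

(** The estimate comes from the strong law of large numbers. For a distribution
function F let [follows F] be the set of the samples x such that, for every
rational q, the proportion of the first 2 ^ m terms of x lying in ]-oo, q]
tends to F q as m grows, fast enough for the squared errors to be summable.
A sample determines the limits of its empirical proportions, and a continuous
F is determined by its values at the rationals, so these sets are pairwise
disjoint ([follows_inj]). Under the law p_F^N, the expected squared error over
n terms is F q (1 - F q) / n; along n = 2 ^ m these expectations form a
convergent geometric series, so the sum of the squared errors is almost surely
finite and [follows F] has full measure ([follows_negligible]). The estimate
sends a sample of [follows F] to F, and any other sample to a fixed
distribution function. The preimage of any set of parameters contains
[follows F] or, off a p_F^N-null set, is empty; so it is everything or nothing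
up to a null set, and belongs to the completed sigma-algebra of each p_F^N
([well_founded_estimate_of_separation]).

Since [countable_power] is a choice among the measures with the product
property, one such measure has to be exhibited ([countable_powerP]). It is the
law of an independent sequence built on the unit interval with the uniform
probability. Separating the binary digits of u of even and odd rank gives two
independent uniform variables [even_digits u] and [odd_digits u]
([digits_independent]): their joint distribution function satisfies the
self-similarity equation of the product of two uniform ones, and that equation
halves errors at each use, so that it has only one bounded solution with the
right boundary values. Iterating [odd_digits] and taking [even_digits] at each
stage yields an independent uniform sequence, which the quantile function of F
turns into an independent sequence of law p_F ([iid_sequence_law]). *)

(** * Measures on the line determined by their values on rays *)

Lemma measure_eq_rays (R : realType)
    (mu nu : {measure set (measurableTypeR R) -> \bar R}) :
  (mu setT < +oo)%E ->
  (forall x : R, mu `]-oo, x]%classic = nu `]-oo, x]%classic) ->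
  forall A, measurable A -> mu A = nu A.
Proof.
move=> muT mnE.
have mufin A : measurable A -> (mu A < +oo)%E.
  by move=> mA; apply: le_lt_trans muT; apply: le_measure; rewrite ?inE.
apply: (@measure_unique _ R (measurableTypeR R) (@ocitv R)
  (fun n => `]- n%:R, n%:R]%classic)) => //.
- exact: ocitvI.
- by move=> i; exact: is_ocitv.
- exact: (bigcup_itvT false false).
- move=> _ [[a b] _ <-] /=.
  have [ab|ba] := leP a b; last first.
    by rewrite set_itv_ge ?measure0// bnd_simp -leNgt ltW.
  have -> : `]a, b]%classic = `]-oo, b] `\` `]-oo, a] :> set R.
    by rewrite -[RHS]setCK setCD setCitvl setUC -[LHS]setCK setCitv.
  have sub : (`]-oo, a] : set R) `<=` `]-oo, b] by exact: subset_itvl.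
  rewrite !measureD// ?setIidr// -?mnE.
  - by congr (_ - _)%E; exact: mnE.
  - by have := mufin `]-oo, b]%classic; rewrite mnE; apply.
  - by apply: mufin.
- by move=> k /=; apply: mufin.
Qed.

(** The form in which independence is obtained from distribution functions: with
c the probability of B and nu the law of X, the hypothesis says that B is independent of the events
X <= x, and the conclusion that it is independent of X. *)
Lemma law_eq_rays d (T : measurableType d) (R : realType)
    (mu : {measure set T -> \bar R}) (B : set T)
    (X : T -> measurableTypeR R) (c : {nonneg R})
    (nu : {measure set (measurableTypeR R) -> \bar R}) :
  (mu setT < +oo)%E -> measurable B -> measurable_fun setT X ->
  (forall x : R, mu (X @^-1` `]-oo, x] `&` B) =
                 (c%:num%:E * nu `]-oo, x]%classic)%E) ->
  forall A, measurable A -> mu (X @^-1` A `&` B) = (c%:num%:E * nu A)%E.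
Proof.
move=> muT mB mX muE A mA.
suff: pushforward (mrestr mu mB) X A = mscale c nu A by [].
apply: measure_eq_rays mA => //.
apply: le_lt_trans muT; rewrite /pushforward /mrestr/=.
by apply: le_measure; rewrite ?inE// preimage_setT setTI.
Qed.

(** The distribution function of the uniform law on [0, 1]. *)
Definition clamp (R : realType) (x : R) : R := Num.max 0 (Num.min x 1).

Lemma clampP (R : realType) (x : R) :
  [\/ x <= 0 /\ clamp x = 0, 0 <= x <= 1 /\ clamp x = x | 1 <= x /\ clamp x = 1].
Proof.
rewrite /clamp; have [x0|x0] := leP x 0.
  by constructor 1; split=> //; rewrite max_l// ge_min x0.
have [x1|x1] := leP x 1; last by constructor 3; split; rewrite ?ltW// max_r.
by constructor 2; rewrite ltW//= max_r// ltW.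
Qed.

Lemma uniform_prob_ray (R : realType) (x : R) :
  uniform_prob (@ltr01 R) `]-oo, x]%classic = (clamp x)%:E.
Proof.
rewrite /uniform_prob integral_uniform_pdf /clamp.
rewrite (eq_integral (fun=> 1%E)); last first.
  move=> y; rewrite inE => -[_]; rewrite /= in_itv/= /uniform_pdf => ->.
  by rewrite subr0 invr1.
rewrite integral_cst/= ?mul1e; last exact: measurableI.
have -> : (`]-oo, x] `&` `[0, 1])%classic = `[0, Num.min x 1]%classic :> set R.
  apply/seteqP; split=> y /=; rewrite !in_itv/= le_min.
    by move=> [yx /andP[-> ->]]; rewrite yx.
  by move=> /and3P[-> -> ->].
rewrite lebesgue_measure_itv/= lte_fin.
by case: ltP => h; rewrite ?oppr0 ?adde0.
Qed.

(** * Binary digits of a uniform variable *)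

Section digits.
Variable R : realType.
Local Notation RM := (measurableTypeR R).
Local Notation P := (uniform_prob (@ltr01 R)).

Definition digit (u : R) : bool := 1 / 2 < u.

(** Drops the first binary digit of a point of [0, 1]. Positive dyadic points get
the expansion that ends in ones, so that the events on the first digit are the
rays ]-oo, 1/2] and ]1/2, +oo[, which suit distribution functions. *)
Definition binary_shift (u : R) : R := 2 * u - (digit u)%:R.

Lemma measurable_digit : measurable_fun [set: RM] (digit : RM -> bool).
Proof. by rewrite /digit; apply: measurable_fun_ltr. Qed.

Lemma measurable_digitR (c : R) :
  measurable_fun [set: RM] ((fun u => (digit u)%:R * c) : RM -> RM).
Proof.
have -> : (fun u => (digit u)%:R * c) = (fun u => if digit u then c else 0).
  by apply/funext => u; case: digit; rewrite ?mul1r ?mul0r.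
by apply: measurable_fun_if => //; exact: measurable_funTS measurable_digit.
Qed.

Lemma measurable_binary_shift : measurable_fun [set: RM] (binary_shift : RM -> RM).
Proof.
rewrite /binary_shift; apply: measurable_funB.
  by apply: measurable_funM.
rewrite (_ : (fun _ => _) = fun u => (digit u)%:R * 1).
  exact: measurable_digitR.
by apply/funext => u; rewrite mulr1.
Qed.

Lemma measurable_digit_eq b : measurable [set u : RM | digit u = b].
Proof.
rewrite -[X in measurable X]setTI.
exact: (measurable_digit measurableT (_ : measurable [set b])).
Qed.

(** The first digit is a fair coin, independent of the remaining digits, which are
again those of a uniform variable: on each half of [0, 1] the shift is an affine
map of slope 2 onto [0, 1], up to an end point. *)
Lemma binary_shift_law (b : bool) (A : set RM) : measurable A ->
  P (binary_shift @^-1` A `&` [set u | digit u = b]) = ((2^-1)%:E * P A)%E.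
Proof.
have muT : (P setT < +oo)%E by rewrite probability_setT ltry.
have mB := measurable_digit_eq b.
have clamp_half : clamp (1 / 2) = 1 / 2 :> R.
  by case: (clampP (1 / 2 : R)) => -[? E]; rewrite E; lra.
apply: (@law_eq_rays _ RM R P _ (binary_shift : RM -> RM) (2^-1 : R)%:nng) => //=.
  exact: measurable_binary_shift.
move=> x; rewrite [in RHS]uniform_prob_ray -EFinM.
have lowE : [set u : R | binary_shift u <= x /\ digit u = false] =
    `]-oo, (Num.min (x / 2) (1 / 2))%R]%classic.
  apply/seteqP; split=> u /=; rewrite in_itv/= le_min /binary_shift /digit.
    by case: ltP => //= h []; lra.
  by case: ltP => //= h /andP[]; lra.
have highE : [set u : R | binary_shift u <= x /\ digit u = true] =
    `]-oo, (Num.max ((x + 1) / 2) (1 / 2))%R] `\` `]-oo, 1 / 2]%classic.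
  apply/seteqP; split=> u /=; rewrite !in_itv/= le_max /binary_shift /digit.
    by case: ltP => //= h []; split => //; apply/orP; left; lra.
  move=> [] + /negP; rewrite -ltNge => + h; rewrite h => /orP[]; last lra.
  by split => //=; lra.
have -> : (binary_shift : RM -> RM) @^-1` `]-oo, x]%classic `&` [set u | digit u = b]
   = [set u | binary_shift u <= x /\ digit u = b].
  by apply/seteqP; split=> u /=; rewrite in_itv.
case: b {mB} => /=.
  rewrite highE measureD//; last by rewrite /= uniform_prob_ray ltry.
  rewrite setIidr.
    rewrite /= !uniform_prob_ray -EFinD; congr (_%:E).
    by case: (leP ((x + 1) / 2) (1 / 2)) => ?; case: (clampP x) => -[? E1];
      case: (clampP ((x + 1) / 2)) => -[? E2]; rewrite ?clamp_half ?E1 ?E2; lra.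
  by apply: subset_itvl; rewrite bnd_simp le_max lexx orbT.
rewrite lowE uniform_prob_ray; congr (_%:E).
by case: (leP (x / 2) (1 / 2)) => ?; case: (clampP x) => -[? E1];
  case: (clampP (x / 2)) => -[? E2]; rewrite ?clamp_half ?E1 ?E2; lra.
Qed.

End digits.

Section splitting.
Variable R : realType.
Local Notation RM := (measurableTypeR R).

(** The number whose binary digits are those of u of ranks 0, 2, .., 2 (n - 1). *)
Fixpoint even_digits_upto (n : nat) (u : R) : R :=
  if n is m.+1 then
    (digit u)%:R / 2 + even_digits_upto m (binary_shift (binary_shift u)) / 2
  else 0.

Definition even_digits (u : R) : R := limn (even_digits_upto ^~ u).

Definition odd_digits (u : R) : R := even_digits (binary_shift u).

Lemma even_digits_upto_bound n u : 0 <= even_digits_upto n u <= 1.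
Proof.
elim: n u => [|n IH] u /=; first by rewrite lexx ler01.
have /andP[h0 h1] := IH (binary_shift (binary_shift u)).
by case: digit => /=; rewrite ?mulr1n ?mulr0n; lra.
Qed.

Lemma even_digits_upto_le n u : even_digits_upto n u <= even_digits_upto n.+1 u.
Proof.
elim: n u => [|n IH] u.
  by have /andP[] := even_digits_upto_bound 1 u.
rewrite -[leLHS]/(_ / 2 + even_digits_upto n _ / 2).
rewrite -[leRHS]/(_ / 2 + even_digits_upto n.+1 _ / 2).
by have := IH (binary_shift (binary_shift u)); lra.
Qed.

Lemma even_digits_cvg u : even_digits_upto n u @[n --> \oo] --> even_digits u.
Proof.
apply: nondecreasing_is_cvgn.
  by apply/nondecreasing_seqP => n; exact: even_digits_upto_le.
by exists 1 => _ [n _ <-]; have /andP[] := even_digits_upto_bound n u.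
Qed.

Lemma even_digits_bound u : 0 <= even_digits u <= 1.
Proof.
apply/andP; split.
  apply: (limr_ge (cvgP _ (@even_digits_cvg u))).
  by apply: nearW => n; have /andP[] := even_digits_upto_bound n u.
apply: (limr_le (cvgP _ (@even_digits_cvg u))).
by apply: nearW => n; have /andP[] := even_digits_upto_bound n u.
Qed.

(** The digits of even rank of u are its first digit followed by the digits of odd
rank of the shifted point: the shift exchanges the two parities. *)
Lemma even_digitsE u :
  even_digits u = (digit u)%:R / 2 + odd_digits (binary_shift u) / 2.
Proof.
apply: cvg_lim => //; rewrite -cvg_shiftS /=.
apply: cvgD; first exact: cvg_cst.
apply: cvgM; last exact: cvg_cst.
exact: even_digits_cvg.
Qed.

Lemma measurable_even_digits_upto n :
  measurable_fun [set: RM] (even_digits_upto n : RM -> RM).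
Proof.
elim: n => [|n IH] /=; first exact: measurable_cst.
apply: measurable_funD; first exact: measurable_digitR.
apply: measurable_funM => //.
apply: measurableT_comp IH _.
by apply: measurableT_comp; exact: measurable_binary_shift.
Qed.

Lemma measurable_even_digits : measurable_fun [set: RM] (even_digits : RM -> RM).
Proof.
apply: (@measurable_fun_cvg _ _ R _ (fun n u => even_digits_upto n u)).
  by move=> n; exact: measurable_even_digits_upto.
by move=> u _; exact: even_digits_cvg.
Qed.

Lemma measurable_odd_digits : measurable_fun [set: RM] (odd_digits : RM -> RM).
Proof.
apply: measurableT_comp measurable_even_digits _; exact: measurable_binary_shift.
Qed.

End splitting.

(** * Independence of the digits of even and odd rank *)

Section independence.
Variable R : realType.
Local Notation RM := (measurableTypeR R).
Local Notation P := (uniform_prob (@ltr01 R)).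

Definition joint_cdf (x y : R) : R :=
  fine (P [set u | even_digits u <= x /\ odd_digits u <= y]).

Lemma measurable_le_set (f : RM -> RM) (x : R) :
  measurable_fun setT f -> measurable [set u | f u <= x].
Proof.
move=> mf; rewrite (_ : mkset _ = f @^-1` `]-oo, x]%classic).
  by rewrite -[X in measurable X]setTI; exact: mf.
by apply/seteqP; split => u /=; rewrite in_itv.
Qed.

Lemma measurable_joint (x y : R) :
  measurable [set u : RM | even_digits u <= x /\ odd_digits u <= y].
Proof.
apply: measurableI; apply: measurable_le_set.
- exact: measurable_even_digits.
- exact: measurable_odd_digits.
Qed.

Lemma joint_cdf_bound x y : 0 <= joint_cdf x y <= 1.
Proof.
rewrite /joint_cdf fine_ge0//=.
rewrite -lee_fin fineK; last by apply: fin_num_measure; exact: measurable_joint.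
by apply: probability_le1; exact: measurable_joint.
Qed.

(** The self-similarity equation: conditioning on the first digit of u, the pair
(even digits, odd digits) of u becomes, up to an affine map of its first
component, the pair (odd digits, even digits) of the shifted point. *)
Lemma joint_cdf_rec x y :
  joint_cdf x y = (joint_cdf y (2 * x) + joint_cdf y (2 * x - 1)) / 2.
Proof.
have mJ := measurable_joint.
pose J z w : set RM := [set u | even_digits u <= z /\ odd_digits u <= w].
have -> : joint_cdf x y = fine
    (P ((@binary_shift R : RM -> RM) @^-1` (J y (2 * x)%R) `&` [set u | digit u = false]) +
     P ((@binary_shift R : RM -> RM) @^-1` (J y (2 * x - 1)%R) `&` [set u | digit u = true]))%E.
  rewrite -measureU.
  (* the digit 0 asks for odd <= 2 x after the shift, the digit 1 for odd <= 2 x - 1 *)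
  - congr (fine (P _)); apply/seteqP; split => u /=; rewrite even_digitsE /J /odd_digits.
      by case: (digit u) => -[/= h1 h2]; [right|left];
        (split => //; split => //; move: h1; rewrite /odd_digits; lra).
    by case=> -[[/= h1 h2] ->]; split => //; move: h2; rewrite /odd_digits/=; lra.
  - apply: measurableI; last exact: measurable_digit_eq.
    by rewrite -[X in measurable X]setTI; exact: (measurable_binary_shift measurableT (mJ _ _)).
  - apply: measurableI; last exact: measurable_digit_eq.
    by rewrite -[X in measurable X]setTI; exact: (measurable_binary_shift measurableT (mJ _ _)).
  - by apply/seteqP; split=> // u [[_ /= ->] []].
have Jfin z w : P (J z w) \is a fin_num by apply: fin_num_measure; exact: mJ.
rewrite !binary_shift_law; [|exact: mJ..].
rewrite fineD ?fin_numM// !fineM// /joint_cdf -/(J _ _) -/(J _ _) /=.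
by lra.
Qed.

Lemma joint_cdf_lt0l x y : x < 0 -> joint_cdf x y = 0.
Proof.
move=> x0; rewrite /joint_cdf (_ : mkset _ = set0) ?measure0//.
apply/seteqP; split => // u [/= h _].
by have := even_digits_bound u; lra.
Qed.

Lemma joint_cdf_ge1l x y : 1 <= x -> joint_cdf x y = joint_cdf 1 y.
Proof.
move=> x0; rewrite /joint_cdf; congr (fine (P _)).
apply/seteqP; split => u [/= h h']; split => //.
  by have /andP[] := even_digits_bound u.
exact: le_trans x0.
Qed.

Lemma joint_cdf_ge1r x y : 1 <= y -> joint_cdf x y = joint_cdf x 1.
Proof.
move=> x0; rewrite /joint_cdf; congr (fine (P _)).
apply/seteqP; split => u [/= h h']; split => //.
  by have /andP[] := even_digits_bound (binary_shift u).
exact: le_trans x0.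
Qed.

Lemma joint_cdf11 : joint_cdf 1 1 = 1.
Proof.
rewrite /joint_cdf (_ : mkset _ = setT) ?probability_setT//.
apply/seteqP; split => // u _; split.
  by have /andP[] := even_digits_bound u.
by have /andP[] := even_digits_bound (binary_shift u).
Qed.

(** The contraction argument: the error f at a point is half the error at some
point of the domain S, so it can be halved indefinitely. *)
Lemma halving_eq (f : R -> R -> R) (S : R -> R -> Prop) :
  (forall x y, S x y -> `|f x y| <= 1) ->
  (forall x y, S x y -> exists x' y', S x' y' /\ f x y = f x' y' / 2) ->
  forall x y, S x y -> f x y = 0.
Proof.
move=> f1 frec x y Sxy; apply/eqP; rewrite -normr_eq0.
have fn n : forall x y, S x y -> `|f x y| <= 2^-1 ^+ n.
  elim: n => [|n IH] {Sxy}x {}y Sxy; first by rewrite expr0 f1.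
  have [x' [y' [S' ->]]] := frec _ _ Sxy.
  by rewrite normrM (ger0_norm (_ : 0 <= 2^-1))// exprSr ler_pM// IH.
rewrite eq_le normr_ge0 andbT.
have h : `|2^-1 : R| < 1 by rewrite ger0_norm// invf_lt1// ltr1n.
apply: (ler_cvg_to _ (cvg_expr h)); first exact: (cvg_cst `|f x y|).
by apply: nearW => n; exact: fn.
Qed.

(** For every x, one of 2 x and 2 x - 1 lies outside [0, 1[, where the marginal
distribution function is known; hence the error at x is half the error at the
other point. The same remark gives [joint_cdfE], whose boundary values are those
found here. *)
Lemma joint_cdfx1 x : joint_cdf x 1 = clamp x.
Proof.
apply/eqP; rewrite -subr_eq0; apply/eqP.
apply: (@halving_eq (fun x y => joint_cdf x y - clamp x) (fun _ y => y = 1)) => //.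
  move=> {x} x _ ->; have := joint_cdf_bound x 1.
  by case: (clampP x) => -[? ->]; rewrite ler_norml; lra.
move=> {x} x _ ->.
(* both marginals agree, by the self-similarity equation at x = 1 *)
have h1 z : joint_cdf 1 z = joint_cdf z 1.
  rewrite joint_cdf_rec (@joint_cdf_ge1r _ (2 * 1)); last lra.
  by rewrite (_ : 2 * 1 - 1 = 1) ?subrK; lra.
rewrite joint_cdf_rec !h1.
have [x0|x0] := ltP (2 * x - 1) 0.
  exists (2 * x), 1; split=> //.
  rewrite (joint_cdf_lt0l _ x0); case: (clampP x) => -[? E1];
  case: (clampP (2 * x)) => -[? E2]; rewrite E1 E2; lra.
exists (2 * x - 1), 1; split=> //.
rewrite (@joint_cdf_ge1l (2 * x)) ?joint_cdf11; last lra.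
case: (clampP x) => -[? E1];
case: (clampP (2 * x - 1)) => -[? E2]; rewrite E1 E2; lra.
Qed.

Lemma joint_cdfE x y : joint_cdf x y = clamp x * clamp y.
Proof.
apply/eqP; rewrite -subr_eq0; apply/eqP.
apply: (@halving_eq (fun x y => joint_cdf x y - clamp x * clamp y)
  (fun _ _ => True)) => // {}x {}y _.
  have := joint_cdf_bound x y; rewrite ler_norml.
  have : 0 <= clamp x * clamp y <= 1.
    by case: (clampP x) => -[? ->]; case: (clampP y) => -[? ->]; nra.
  by lra.
exists y; rewrite joint_cdf_rec.
have [x0|x0] := ltP (2 * x - 1) 0.
  exists (2 * x); split=> //.
  rewrite (_ : joint_cdf y (2 * x - 1) = 0).
    have -> : clamp (2 * x) = 2 * clamp x.
      by case: (clampP x) => -[? E1];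
        case: (clampP (2 * x)) => -[? E2]; rewrite E1 E2; lra.
    by lra.
  by rewrite joint_cdf_rec !(@joint_cdf_lt0l (2 * x - 1))// addr0 mul0r.
exists (2 * x - 1); split=> //.
rewrite (@joint_cdf_ge1r _ (2 * x)) ?joint_cdfx1; last lra.
have -> : clamp (2 * x - 1) = 2 * clamp x - 1.
  by case: (clampP x) => -[? E1];
    case: (clampP (2 * x - 1)) => -[? E2]; rewrite E1 E2; lra.
by lra.
Qed.

Lemma digits_independent (A B : set RM) : measurable A -> measurable B ->
  P [set u | A (even_digits u) /\ B (odd_digits u)] = (P A * P B)%E.
Proof.
move=> mA mB.
have muT : (P setT < +oo)%E by rewrite probability_setT ltry.
have mE := @measurable_even_digits R; have mO := @measurable_odd_digits R.
have mpre (f : RM -> RM) (C : set RM) : measurable_fun setT f -> measurable C ->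
    measurable (f @^-1` C).
  by move=> mf mC; rewrite -[X in measurable X]setTI; exact: mf.
(* the rays are replaced by measurable sets in one component, then in the other *)
have ray y : P ((@even_digits R : RM -> RM) @^-1` A `&`
     (@odd_digits R : RM -> RM) @^-1` `]-oo, y]%classic) = ((clamp y)%:E * P A)%E.
  have c0 : 0 <= clamp y by rewrite /clamp le_max lexx.
  apply: (@law_eq_rays _ RM R P _ _ (NngNum c0)) => //=; first exact: mpre.
  move=> x; rewrite uniform_prob_ray -EFinM mulrC -joint_cdfE /joint_cdf fineK.
    by congr (P _); apply/seteqP; split=> u /=; rewrite !in_itv.
  by apply: fin_num_measure; exact: measurable_joint.
have fA : P A \is a fin_num by exact: fin_num_measure.
have c0 : 0 <= fine (P A) by rewrite fine_ge0.
transitivity (P ((@odd_digits R : RM -> RM) @^-1` B `&` (@even_digits R : RM -> RM) @^-1` A)).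
  by rewrite setIC.
rewrite -[in RHS](fineK fA).
apply: (@law_eq_rays _ RM R P _ _ (NngNum c0)) => //=; first exact: mpre.
by move=> x; rewrite uniform_prob_ray (fineK fA) setIC ray muleC.
Qed.

End independence.

(** * Quantile functions *)

Section quantile.
Variables (R : realType) (F : sc_distribution R).
Local Notation RM := (measurableTypeR R).
Local Notation P := (uniform_prob (@ltr01 R)).

Lemma sc_distribution_mono : {mono (sval F : R -> R) : x y / x <= y}.
Proof. by apply: le_mono; case: F => f [] . Qed.

Lemma sc_distribution_bound (x : R) : 0 < (sval F : R -> R) x < 1.
Proof.
have mono := leW_mono sc_distribution_mono.
have b01 y : 0 <= (sval F : R -> R) y <= 1.
  rewrite -2!lee_fin -measure_ofE probability_le1// andbT.
  exact: measure_ge0.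
have := b01 (x - 1); have := b01 (x + 1).
have : (sval F : R -> R) (x - 1) < (sval F : R -> R) x by rewrite mono; lra.
have : (sval F : R -> R) x < (sval F : R -> R) (x + 1) by rewrite mono; lra.
lra.
Qed.

(** The inverse of F on ]0, 1[, which is the range of F; the default value 0 is
taken elsewhere. *)
Definition quantile (t : R) : R := xget 0 [set x | (sval F : R -> R) x = t].

Lemma quantileK (t : R) : 0 < t < 1 -> (sval F : R -> R) (quantile t) = t.
Proof.
move=> /andP[t0 t1]; rewrite /quantile; case: xgetP => // noroot; exfalso.
have cF : continuous (sval F : R -> R) by case: F => f [].
have [a Fa] : exists a, (sval F : R -> R) a < t.
  have /cvgrPdist_lt /(_ _ t0) [M [_ MP]] := cumulativeNy (sval F).
  exists (M - 1); have := MP (M - 1); rewrite ltrBlDr ltrDl ltr01 => /(_ isT).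
  by rewrite sub0r normrN; apply: le_lt_trans; exact: ler_norm.
have [b Fb] : exists b, t < (sval F : R -> R) b.
  have t1' : 0 < 1 - t by rewrite subr_gt0.
  have /cvgrPdist_lt /(_ _ t1') [M [_ MP]] := cumulativey (sval F).
  exists (M + 1); have := MP (M + 1); rewrite ltrDl ltr01 => /(_ isT) h.
  by have := le_lt_trans (ler_norm _) h; lra.
have ab : a <= b by rewrite -sc_distribution_mono ltW// (lt_trans Fa).
have [||c _ Fc] := @IVT R (sval F) a b t ab; last exact: (noroot c).
  by apply: continuous_subspaceT => z; exact: cF.
by rewrite ge_min le_max (ltW Fa) (ltW Fb) orbT.
Qed.

Lemma quantile_le (t x : R) : 0 < t < 1 ->
  (quantile t <= x) = (t <= (sval F : R -> R) x).
Proof.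
by move=> t01; rewrite -sc_distribution_mono quantileK.
Qed.

Lemma quantile_out (t : R) : ~~ (0 < t < 1) -> quantile t = 0.
Proof.
move=> t01; rewrite /quantile; case: xgetP => // y _ /= Fy.
by move: t01; rewrite -Fy sc_distribution_bound.
Qed.

Lemma quantile_preim x : quantile @^-1` `]-oo, x]%classic =
  (`]0, 1[ `&` `]-oo, (sval F : R -> R) x]) `|`
  (~` `]0, 1[ `&` (if 0 <= x then setT else set0)).
Proof.
apply/seteqP; split => t /=; rewrite !in_itv/=.
  have [t01|t01] := boolP (0 < t < 1); first by rewrite quantile_le//; left.
  by rewrite quantile_out// => ->; right; split => //; rewrite in_itv/=; exact/negP.
move=> [[t01]|[/negP]]; first by rewrite quantile_le.
by move=> t01; rewrite quantile_out//; case: (0 <= x).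
Qed.

Lemma measurable_quantile_preim x :
  measurable ((quantile : RM -> RM) @^-1` `]-oo, x]%classic).
Proof.
rewrite quantile_preim; apply: measurableU; apply: measurableI => //.
  exact: measurableC.
by case: ifP.
Qed.

Lemma measurable_quantile : measurable_fun [set: RM] (quantile : RM -> RM).
Proof.
apply: (measurability (@RGenOInfty.G R)) => [|/= _ [_] [x] -> <-].
  exact: RGenOInfty.measurableE.
rewrite setTI -[X in measurable X]setCK; apply: measurableC.
rewrite preimage_setC setCitvr; exact: measurable_quantile_preim.
Qed.

(** The conditions quantile t <= x and t <= F x are equivalent on the open unit
interval, which carries the whole uniform measure. *)
Lemma quantile_law_ray x :
  P (quantile @^-1` `]-oo, x]%classic) = ((sval F : R -> R) x)%:E.
Proof.
have mq := measurable_quantile_preim x.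
have mr : measurable (`]-oo, (sval F : R -> R) x]%classic : set RM) by [].
have mI : measurable (~` `]0, 1[%classic : set RM) by exact: measurableC.
have null : P (~` `]0, 1[%classic) = 0%E.
  have N0 : P `]-oo, 0]%classic = 0%E.
    by rewrite uniform_prob_ray /clamp max_l// ge_min lexx.
  have N1 : P [set 1] = 0%E.
    apply: (null_content_dominatesP _ _).1 (dominates_uniform_prob (@ltr01 R)) _ _ _ => //.
    exact: lebesgue_measure_set1.
  have N2 : P `]1, +oo[%classic = 0%E.
    rewrite -setCitvl probability_setC//= uniform_prob_ray /clamp minxx max_r//.
    by rewrite subee.
  have nN : P.-negligible ((`]-oo, 0] `|` [set 1]) `|` `]1, +oo[ : set RM)%classic.
    by apply: negligibleU; first apply: negligibleU; apply/negligibleP.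
  apply: (measure_negligible mI (negligibleS _ nN)) => t /=.
  rewrite !in_itv/= => /negP.
  have [->|t1] := eqVneq t 1; first by left; right.
  rewrite negb_and -!leNgt (le_eqVlt 1) eq_sym (negbTE t1) => /orP[];
    by [left; left|right; rewrite andbT].
have sub (A B : set RM) : measurable A -> measurable B ->
    A `<=` B `|` ~` `]0, 1[%classic -> (P A <= P B)%E.
  move=> mA mB AB; rewrite -[leRHS]adde0 -null.
  apply: le_trans (measureU2 _ _ _) => //.
  by apply: le_measure; rewrite ?inE//; exact: measurableU.
transitivity (P `]-oo, (sval F : R -> R) x]%classic).
  apply/eqP; rewrite eq_le !sub// quantile_preim => t /=.
    have [t01|t01] := pselect (`]0, 1[%classic t); last by right.
    by move=> h; left; left.
  by move=> [[]|[]] *; [left|right].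
rewrite uniform_prob_ray; have := sc_distribution_bound x.
by case: (clampP ((sval F : R -> R) x)) => -[? ->] ?; congr (_%:E); lra.
Qed.

Lemma quantile_law (A : set RM) : measurable A ->
  P (quantile @^-1` A) = measure_of F A.
Proof.
move=> mA; have muT : (P setT < +oo)%E by rewrite probability_setT ltry.
rewrite -[LHS]/(P ((quantile : RM -> RM) @^-1` A)) -[X in P X]setIT -[RHS]mul1e.
apply: (@law_eq_rays _ RM R P setT _ (1 : R)%:nng (measure_of F)) => //.
  exact: measurable_quantile.
move=> x; rewrite setIT mul1e; apply: etrans (quantile_law_ray x) _.
exact/esym/measure_ofE.
Qed.

End quantile.

(** * An independent sequence with a given law *)

Section iid.
Variables (R : realType) (F : sc_distribution R).
Local Notation RM := (measurableTypeR R).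
Local Notation P := (uniform_prob (@ltr01 R)).

Definition iid_sequence (u : R) : nat -> R :=
  fun n => quantile F (even_digits (iter n (@odd_digits R) u)).

Lemma measurable_iid_sequence n :
  measurable_fun [set: RM] ((fun u => iid_sequence u n) : RM -> RM).
Proof.
have miter : measurable_fun [set: RM] ((fun u => iter n (@odd_digits R) u) : RM -> RM).
  elim: n => [|n IH]; first exact: measurable_id.
  by apply: measurableT_comp IH; exact: measurable_odd_digits.
apply: measurableT_comp; first exact: measurable_quantile.
by apply: measurableT_comp miter; exact: measurable_even_digits.
Qed.

(** By induction on n: the first term depends on the digits of even rank of u only,
and the following ones are the same sequence started at [odd_digits u], which is
uniform and independent of the digits of even rank. *)
Lemma iid_sequence_law (n : nat) (A : nat -> set RM) :
  (forall k, measurable (A k)) ->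
  P [set u | forall k, (k < n)%N -> A k (iid_sequence u k)] =
  (\prod_(k < n) measure_of F (A k))%E.
Proof.
elim: n A => [|n IH] A mA.
  rewrite big_ord0 (_ : mkset _ = setT) ?probability_setT//.
  by apply/seteqP; split.
rewrite big_ord_recl (eq_bigr (fun k : 'I_n => measure_of F (A k.+1)))//.
rewrite -(IH (fun k => A k.+1))// -quantile_law//.
have mq (k : nat) : measurable ((quantile F : RM -> RM) @^-1` A k).
  by rewrite -[X in measurable X]setTI; exact: measurable_quantile.
rewrite -digits_independent //.
  congr (P _); apply/seteqP; split=> u /=.
    move=> h; split; first exact: (h 0%N).
    by move=> k kn; have := h k.+1 kn; rewrite /iid_sequence iterSr.
  move=> [h0 h] [_|k kn]; first exact: h0.
  by have := h k kn; rewrite /iid_sequence iterSr.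
rewrite (_ : mkset _ = \bigcap_(k in `I_n)
    ((iid_sequence ^~ k : RM -> RM) @^-1` A k.+1)); last by [].
apply: bigcap_measurableType => // k _.
by rewrite -[X in measurable X]setTI; exact: measurable_iid_sequence.
Qed.

End iid.

(** * Measurability in the space of sequences *)

Section sequence_space.
Variable R : realType.
Local Notation RM := (measurableTypeR R).

Definition rational_box (s : seq (rat * rat)) : set (nat -> R) :=
  [set x | forall k, (k < size s)%N ->
     ratr (nth (0, 0) s k).1 < x k < ratr (nth (0, 0) s k).2].

(** Boxes constrain finitely many coordinates by rational intervals, hence form a
countable base of the product topology. If no box around x were contained in U,
the boxes of side at most 2 / n on the first n coordinates would provide
sequences outside U which converge pointwise to x. *)
Lemma open_rational_box (U : set {ptws nat -> R}) (x : nat -> R) :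
  open U -> U x -> exists s, rational_box s x /\ rational_box s `<=` U.
Proof.
move=> oU Ux; apply: contrapT => noboxes.
have approx n : exists y : nat -> R, ~ U y /\
    forall k, (k < n)%N -> `|x k - y k| < 2 / n%:R.
  have [->|n0] := posnP n.
    apply: contrapT => h; apply: noboxes; exists [::]; split => // y _.
    by apply: contrapT => Uy; apply: h; exists y; split.
  have e0 : 0 < n%:R^-1 :> R by rewrite invr_gt0 ltr0n.
  have ex k : exists q : rat * rat,
      [/\ x k - n%:R^-1 < ratr q.1, ratr q.1 < x k, x k < ratr q.2 & ratr q.2 < x k + n%:R^-1].
    have [q1] := @rat_in_itvoo R (x k - n%:R^-1) (x k) (ltac:(lra)).
    have [q2] := @rat_in_itvoo R (x k) (x k + n%:R^-1) (ltac:(lra)).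
    rewrite !in_itv/= => /andP[h1 h2] /andP[h3 h4].
    by exists (q1, q2).
  have /choice [q qP] := ex.
  have nthq k : (k < n)%N -> nth (0, 0) (mkseq q n) k = q k by exact: nth_mkseq.
  apply: contrapT => h; apply: noboxes; exists (mkseq q n); split.
    by move=> k; rewrite size_mkseq => kn; rewrite nthq//; have [_ -> ->] := qP k.
  move=> y yq; apply: contrapT => Uy; apply: h; exists y; split => // k kn.
  have := yq k; rewrite size_mkseq nthq// => /(_ kn) /andP[].
  by have [] := qP k => *; rewrite ltr_norml; apply/andP; split; lra.
have /choice [y yP] := approx.
have : {ptws, y @ \oo --> (x : nat -> R)}.
  apply/pointwise_cvgP => k.
  suff : y n k @[n --> \oo] --> (x k : R) by [].
  apply/cvgrPdist_lt => e e0.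
  near=> n; have [_ /(_ k) h] := yP n.
  apply: (lt_trans (h _)); first by near: n; exact: nbhs_infty_gt.
  rewrite ltr_pdivrMr ?ltr0n; last by near: n; exact: nbhs_infty_gt.
  by rewrite mulrC -ltr_pdivrMr//; near: n; exact: nbhs_infty_gtr.
move=> /(_ U) [|N _ NU]; first exact: open_nbhs_nbhs.
by have [nU _] := yP N; apply: nU; exact: (NU N (leqnn N)).
Unshelve. all: by end_near. Qed.

Lemma measurable_coordinate (k : nat) :
  measurable_fun [set: seqR R] ((fun x : seqR R => x k) : seqR R -> RM).
Proof.
apply: (measurability (@RGenOInfty.G R)) => [|_ [_ [a ->] <-]].
  exact: RGenOInfty.measurableE.
rewrite setTI; apply: sub_sigma_algebra.
apply: (open_comp (f := fun x : {ptws nat -> R} => x k)) => //.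
by move=> x _; exact: (@proj_continuous nat (fun _ => R) k).
Qed.

(** The Borel sigma-algebra of the product topology is not larger than the product
sigma-algebra, since every open set is a countable union of boxes. *)
Lemma measurable_sequence d (T : measurableType d) (f : T -> seqR R) :
  (forall k, measurable_fun [set: T] ((fun t => f t k) : T -> RM)) ->
  measurable_fun [set: T] f.
Proof.
move=> mf; apply: (@measurability _ _ T (seqR R) _ _ (@open {ptws nat -> R})) => [//|_ [U oU <-]].
rewrite setTI.
have -> : f @^-1` U = \bigcup_n (f @^-1` [set x | exists s,
    [/\ unpickle n = Some s, rational_box s `<=` U & rational_box s x]]).
  apply/seteqP; split => t.
    move=> /(open_rational_box oU) [s [sx sU]].
    by exists (pickle s) => //; exists s; rewrite pickleK.
  by move=> [n _ [s [_ sU sx]]]; exact: sU.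
apply: bigcup_measurable => n _.
case: (@unpickle (seq (rat * rat)) n) => [s|]; last first.
  rewrite [X in measurable X](_ : _ = set0)//; apply/seteqP; split => // t [s []] //.
have [sU|sU] := pselect (rational_box s `<=` U); last first.
  rewrite [X in measurable X](_ : _ = set0)//; apply/seteqP; split => // t [r []].
  by move=> -[<-].
rewrite [X in measurable X](_ : _ = \bigcap_(k in `I_(size s))
  ((fun t => f t k : RM) @^-1` `]ratr (nth (0, 0) s k).1, ratr (nth (0, 0) s k).2[)).
  apply: bigcap_measurableType => // k _.
  by rewrite -[X in measurable X]setTI; exact: mf.
apply/seteqP; split => t.
  move=> [r [[<-]]] _ rt k /= ks.
  by rewrite in_itv/=; exact: rt.
by move=> h; exists s.
Qed.

End sequence_space.

Section countable_power_exists.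
Variables (R : realType) (F : sc_distribution R).
Local Notation RM := (measurableTypeR R).
Local Notation P := (uniform_prob (@ltr01 R)).

(** The law of [iid_sequence F] has the product property, so the measure chosen by
[countable_power] has it too. *)
Lemma countable_powerP : is_countable_power (measure_of F) (countable_power (measure_of F)).
Proof.
rewrite /countable_power.
suff [Q QP] : exists Q, is_countable_power (measure_of F) Q by exact: (getPex (ex_intro _ Q QP)).
have mX : measurable_fun [set: RM] (iid_sequence F : RM -> seqR R).
  by apply: measurable_sequence => k; exact: measurable_iid_sequence.
pose X : {mfun RM >-> seqR R} := MeasurableFun.Pack (MeasurableFun.Class
  (isMeasurableFun.Build _ _ RM (seqR R) _ mX)).
exists (distribution P X) => n A mA.
exact: iid_sequence_law.
Qed.

End countable_power_exists.

(** * Estimates from pairwise disjoint sets of full measure *)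

Section separation.
Context d (X : measurableType d) (R : realType) (I : Type).
Variable mu : I -> probability X R.

(** The estimate sends A i to i. For each i, the preimage of a set J of parameters
is, outside a measurable null set M containing the complement of A i, everything
if i is in J and empty otherwise; so it lies in the completed sigma-algebra of
mu i, for every J. *)
Lemma well_founded_estimate_of_separation (i0 : I) (A : I -> set X) :
  (forall i j x, A i x -> A j x -> i = j) ->
  (forall i, (mu i).-negligible (~` A i)) ->
  exists T, well_founded_estimate mu T.
Proof.
move=> Ainj Anull.
have /choice [T TP] (x : X) : exists i, (exists j, A j x) -> A i x.
  by have [[j Aj]|none] := pselect (exists j, A j x); [exists j|exists i0].
have TA i x : A i x -> T x = i.
  by move=> Aix; apply: (Ainj _ _ x) => //; apply: TP; exists i.
have core i J : exists2 B, measurable B & exists2 N, (mu i).-negligible N &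
    B `|` N = T @^-1` J /\ (J i -> mu i B = 1%E).
  have [M [mM M0 AM]] := Anull i.
  have TM x : ~ M x -> T x = i.
    by move=> Mx; apply: TA; apply: contrapT => /AM.
  have [Ji|Ji] := pselect (J i).
    exists (~` M); first exact: measurableC.
    exists (T @^-1` J `&` M).
      by apply: (@negligibleS _ _ _ _ M); [exact: subIsetr|exact/negligibleP].
    split; last by move=> _; have := probability_setC (mu i) mM; rewrite M0 sube0.
    apply/seteqP; split => x /=.
      by move=> [/TM ->//|[]].
    by move=> Jx; have [Mx|Mx] := pselect (M x); [right|left].
  exists set0 => //; exists (T @^-1` J); last by rewrite set0U.
  apply: (@negligibleS _ _ _ _ M); last exact/negligibleP.
  by move=> x /= Jx; apply: contrapT => /TM Tx; apply: Ji; rewrite -Tx.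
exists T; split => [J _ i _|i].
  by have [B mB [N nN [E _]]] := core i J; exists B => //; exists N.
have [B mB [N nN [<- B1]]] := core i [set i].
by rewrite completionE//; exact: B1.
Qed.

End separation.

(** * The law of large numbers along powers of two *)

Section mean.
Context d (T : measurableType d) (R : realType) (P : probability T R).

Definition has_mean (f : T -> R) (a : R) : Prop :=
  P.-integrable setT (EFin \o f) /\ (\int[P]_x (f x)%:E = a%:E)%E.

Lemma has_mean_indic (A : set T) (a : R) :
  measurable A -> P A = a%:E -> has_mean \1_A a.
Proof.
move=> mA PA; split; first exact: integrable_indic.
by rewrite integral_indic// setIT.
Qed.

Lemma has_mean_cst (a : R) : has_mean (cst a) a.
Proof.
split; first exact: finite_measure_integrable_cst.
rewrite (integral_cst P measurableT a%:E).
by transitivity (a%:E * P setT)%E => //; rewrite probability_setT mule1.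
Qed.

Lemma has_meanD (f g : T -> R) (a b : R) :
  has_mean f a -> has_mean g b -> has_mean (f \+ g) (a + b).
Proof.
move=> [intf Ef] [intg Eg]; split.
  exact: (integrableD measurableT intf intg).
rewrite EFinD -Ef -Eg.
by apply: etrans (integralD_EFin measurableT intf intg); exact: eq_integral.
Qed.

Lemma has_meanZ (f : T -> R) (a c : R) :
  has_mean f a -> has_mean (fun x => c * f x) (c * a).
Proof.
move=> [intf Ef]; split; first exact: (integrableZl measurableT c intf).
by rewrite EFinM -Ef -(integralZl measurableT intf).
Qed.

Lemma has_mean_sum (I : Type) (s : seq I) (f : I -> T -> R) (a : I -> R) :
  (forall i, has_mean (f i) (a i)) ->
  has_mean (fun x => \sum_(i <- s) f i x) (\sum_(i <- s) a i).
Proof.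
move=> fa; elim: s => [|i s IH].
  rewrite big_nil (_ : (fun x => _) = cst 0); first exact: has_mean_cst.
  by apply/funext => x; rewrite big_nil.
rewrite big_cons (_ : (fun x => _) = f i \+ (fun x => \sum_(j <- s) f j x)).
  exact: has_meanD.
by apply/funext => x; rewrite big_cons.
Qed.

End mean.

Section law_of_large_numbers.
Context d (T : measurableType d) (R : realType) (P : probability T R).
Variables (E : nat -> set T) (p : R).
Hypotheses (mE : forall k, measurable (E k)).
Hypothesis E1 : forall k, P (E k) = p%:E.
Hypothesis E2 : forall j k, j != k -> P (E j `&` E k) = (p * p)%:E.

Definition frequency (n : nat) (x : T) : R := (\sum_(k < n) \1_(E k) x) / n%:R.

(** Sampling along the powers of two makes the variances of the successive
frequencies summable, so that second moments suffice. *)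
Definition quadratic_error (x : T) : \bar R :=
  (\sum_(m <oo) ((frequency (2 ^ m) x - p) ^+ 2)%:E)%E.

Lemma has_mean_covariance j k :
  has_mean P (fun x => (\1_(E j) x - p) * (\1_(E k) x - p))
    (if j == k then p - p * p else 0).
Proof.
(* expand the product, where 1_(E j) 1_(E k) is the indicator of E j `&` E k *)
rewrite (_ : (fun x => _) = (\1_(E j `&` E k) \+ (fun x => - p * \1_(E j) x)) \+
  ((fun x => - p * \1_(E k) x) \+ cst (p * p))); last first.
  by apply/funext => x /=; rewrite indicI /=; lra.
have E12 : P (E j `&` E k) = (if j == k then p else p * p)%:E.
  by case: eqVneq => [->|jk]; [rewrite setIid|exact: E2].
rewrite (_ : (if _ then _ else _) =
    (if j == k then p else p * p) + - p * p + (- p * p + p * p)); last first.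
  by case: ifP => _; lra.
apply: has_meanD; apply: has_meanD.
- by apply: has_mean_indic => //; exact: measurableI.
- by apply: has_meanZ; exact: has_mean_indic.
- by apply: has_meanZ; exact: has_mean_indic.
- exact: has_mean_cst.
Qed.

Lemma has_mean_frequency (n : nat) : (0 < n)%N ->
  has_mean P (fun x => (frequency n x - p) ^+ 2) ((p - p * p) / n%:R).
Proof.
move=> n0; have nn0 : n%:R != 0 :> R by rewrite pnatr_eq0 -lt0n.
have := has_meanZ (n%:R^-1 ^+ 2) (has_mean_sum (index_enum 'I_n)
  (fun j => has_mean_sum (index_enum 'I_n)
    (fun k => has_mean_covariance j k))).
congr (has_mean _ _ _).
  apply/funext => x; rewrite /frequency.
  have -> : (\sum_(k < n) \1_(E k) x) / n%:R - p =
      n%:R^-1 * \sum_(k < n) (\1_(E k) x - p).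
    by rewrite sumrB sumr_const card_ord -[p *+ n]mulr_natr; field.
  rewrite exprMn; congr (_ * _); rewrite expr2 mulr_suml.
  by apply: eq_bigr => j _; rewrite mulr_sumr.
(* only the n diagonal covariances contribute *)
under eq_bigr => j _.
  rewrite (bigD1 j)//= eqxx big1 ?addr0; last first.
    by move=> k kj; rewrite eq_sym (negbTE (kj : (k : nat) != j)).
  over.
by rewrite sumr_const card_ord -mulr_natr; field.
Qed.

Lemma measurable_frequency n : measurable_fun setT (frequency n).
Proof.
rewrite /frequency; apply: measurable_funM => //.
by apply: measurable_sum => k; exact: measurable_indic.
Qed.

Lemma quadratic_error_negligible :
  P.-negligible (~` [set x | quadratic_error x < +oo]%E).
Proof.
have msq m : measurable_fun setT (fun x => ((frequency (2 ^ m) x - p) ^+ 2)%:E).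
  apply/measurable_EFinP; apply: measurable_funX.
  by apply: measurable_funB => //; exact: measurable_frequency.
have sq0 m x : (0 <= ((frequency (2 ^ m) x - p) ^+ 2)%:E)%E.
  by rewrite lee_fin sqr_ge0.
have mq : measurable_fun setT quadratic_error by exact: ge0_emeasurable_sum.
have q0 x : (0 <= quadratic_error x)%E by exact: nneseries_ge0.
have iq : P.-integrable setT quadratic_error.
  apply/integrableP; split => //.
  under eq_integral do rewrite gee0_abs//.
  rewrite integral_nneseries//.
  (* p - p ^ 2 <= 1 bounds the m-th expectation by 2 ^ - m = 2 / 2 ^ (m + 1) *)
  have le m : (\int[P]_x ((frequency (2 ^ m) x - p) ^+ 2)%:E <=
      (2 / (2 ^ m.+1)%:R)%:E)%E.
    have [_ ->] := has_mean_frequency (expn_gt0 2 m : (0 < 2 ^ m)%N).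
    have h : (0 < (2 ^ m)%:R :> R) by rewrite ltr0n expn_gt0.
    rewrite lee_fin expnS natrM invfM mulrA divff// mul1r.
    by rewrite ler_pdivrMr// mulVf ?gt_eqF//; nra.
  apply: (@le_lt_trans _ _ (\sum_(m <oo) (2 / (2 ^ m.+1)%:R)%:E)%E).
    by apply: lee_nneseries => m *; [exact: integral_ge0|exact: le].
  by apply: (le_lt_trans (epsilon_trick0 _ _)) => //; rewrite ltry.
have [N [mN N0 sN]] := integrable_ae measurableT iq.
exists N; split => // x /= /negP; rewrite -leNgt leye_eq => /eqP qx.
by apply: sN => /= /(_ I); rewrite qx.
Qed.

End law_of_large_numbers.

Lemma negligible_setC_forall d (T : measurableType d) (R : realType)
    (mu : {measure set T -> \bar R}) (I : countType) (A : I -> set T) :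
  (forall i, mu.-negligible (~` A i)) ->
  mu.-negligible (~` [set x | forall i, A i x]).
Proof.
move=> nA.
have -> : ~` [set x | forall i, A i x] =
    \bigcup_n (if unpickle n is Some i then ~` A i else set0).
  apply/seteqP; split => x.
    move=> /existsNP[i xi]; exists (pickle i) => //.
    by rewrite pickleK.
  move=> [n _]; case: unpickle => [i xi h|//].
  exact: (xi (h i)).
apply: negligible_bigcup => n; case: unpickle => [i|]; first exact: nA.
exact: negligible_set0.
Qed.

(** * Samples that follow a distribution function *)

Section estimation.
Variable R : realType.
Local Notation RM := (measurableTypeR R).

Lemma frequency_cvg d (T : measurableType d) (E : nat -> set T) (p : R) (x : T) :
  (quadratic_error E p x < +oo)%E ->
  frequency R E (2 ^ m) x @[m --> \oo] --> p.
Proof.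
move=> Qfin; pose u m : R := (frequency R E (2 ^ m) x - p) ^+ 2.
have u0 m : (0 <= (u m)%:E)%E by rewrite lee_fin sqr_ge0.
have Q0 : (0 <= quadratic_error E p x)%E by apply: nneseries_ge0 => m *; exact: u0.
have cvgu : cvgn (series u).
  apply: nondecreasing_is_cvgn.
    by apply/nondecreasing_seqP => n; rewrite seriesSr lerDl sqr_ge0.
  exists (fine (quadratic_error E p x)) => _ [n _ <-].
  rewrite -lee_fin fineK ?ge0_fin_numE// /series/= -sumEFin.
  exact: (@nneseries_lim_ge R (fun m => (u m)%:E) xpredT 0%N n).
have /cvgrPdist_lt u_cvg := cvg_series_cvg_0 cvgu.
apply/cvgrPdist_lt => e e0; have e2 : 0 < e ^+ 2 by rewrite exprn_gt0.
near=> m; have : `|0 - u m| < e ^+ 2 by near: m; exact: u_cvg.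
rewrite sub0r normrN ger0_norm ?sqr_ge0// /u -real_normK ?num_real//.
by rewrite ltr_pXn2r ?nnegrE ?normr_ge0 ?ltW// distrC.
Unshelve. all: by end_near. Qed.

Definition follows (F : sc_distribution R) : set (seqR R) :=
  [set x | forall q : rat,
    (quadratic_error (fun k => [set y : seqR R | (y k <= ratr q)%R])
       ((sval F : R -> R) (ratr q)) x < +oo)%E].

Lemma follows_inj (F G : sc_distribution R) x : follows F x -> follows G x -> F = G.
Proof.
move=> xF xG; apply: sc_distribution_inj.
have FGq (q : rat) : (sval F : R -> R) (ratr q) = (sval G : R -> R) (ratr q).
  exact: (cvg_unique _ (frequency_cvg (xF q)) (frequency_cvg (xG q))).
have cF : continuous (sval F : R -> R) by case: F {xF FGq} => f [].
have cG : continuous (sval G : R -> R) by case: G {xG FGq} => f [].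
apply/funext => t; apply: contrapT => FGt.
(* F and G would differ on a nonempty open set, hence at some rational *)
pose D := ((sval F : R -> R) \- (sval G : R -> R)) @^-1` [set~ 0].
have oD : open D.
  apply: open_comp; last by apply: closed_openC; exact: closed_eq.
  by move=> z _; apply: continuousB; [exact: cF|exact: cG].
have [|y [Dy [q _ qE]]] := @dense_rat R D _ oD.
  by exists t; rewrite /D/= => /eqP; rewrite subr_eq0 => /eqP.
by move: Dy; rewrite -qE; apply; rewrite /= FGq subrr.
Qed.

Section countable_power_events.
Context (p : probability RM R) (P : probability (seqR R) R).
Hypothesis Pp : is_countable_power p P.

Lemma countable_power_coordinate (B : set RM) (j : nat) : measurable B ->
  P [set x : seqR R | B (x j)] = p B.
Proof.
move=> mB; pose A k := if k == j then B else setT.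
have mA k : measurable (A k) by rewrite /A; case: ifP.
transitivity (P [set x | forall k, (k < j.+1)%N -> A k (x k)]).
  congr (P _); apply/seteqP; split=> x /=.
    by move=> Bx k _; rewrite /A; case: eqVneq => [->|].
  by move=> /(_ j (ltnSn j)); rewrite /A eqxx.
rewrite Pp// big_ord_recr/= {2}/A eqxx big1 ?mul1e// => k _.
by rewrite /A ltn_eqF// probability_setT.
Qed.

Lemma countable_power_coordinates2 (B : set RM) (j k : nat) :
  measurable B -> j != k ->
  P ([set x : seqR R | B (x j)] `&` [set x | B (x k)]) = (p B * p B)%E.
Proof.
move=> mB jk; pose A i := if (i == j) || (i == k) then B else setT.
have mA i : measurable (A i) by rewrite /A; case: ifP.
pose n := (maxn j k).+1.
have jn : (j < n)%N by rewrite ltnS leq_maxl.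
have kn : (k < n)%N by rewrite ltnS leq_maxr.
transitivity (P [set x | forall i, (i < n)%N -> A i (x i)]).
  congr (P _); apply/seteqP; split=> x /=.
    by move=> [Bj Bk] i _; rewrite /A; have [->//|_] := eqVneq i j; case: eqVneq => [->|].
  move=> h; have := h j jn; have := h k kn.
  by rewrite /A !eqxx orbT orTb; split.
rewrite Pp// (bigD1 (Ordinal jn))//= (bigD1 (Ordinal kn))/=; last first.
  by rewrite -val_eqE/= eq_sym.
rewrite [in X in (X * _)%E]/A [in X in (_ * (X * _))%E]/A !eqxx orbT big1 ?mule1// => i.
by rewrite -!val_eqE/= /A => /andP[/negbTE -> /negbTE ->]; rewrite probability_setT.
Qed.

End countable_power_events.

Lemma follows_negligible (F : sc_distribution R) :
  (countable_power (measure_of F)).-negligible (~` follows F).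
Proof.
have Pp := countable_powerP F.
move: (countable_power _) Pp => P Pp.
pose A q := [set x : seqR R | (quadratic_error (fun k => [set y : seqR R | (y k <= ratr q)%R])
       ((sval F : R -> R) (ratr q)) x < +oo)%E].
have nA q : P.-negligible (~` A q).
  have mr : measurable (`]-oo, ratr q]%classic : set RM) by [].
  have EE k : [set y : seqR R | (y k <= ratr q)%R] =
      [set y : seqR R | (`]-oo, ratr q]%classic : set RM) (y k)].
    by apply/seteqP; split => y /=; rewrite in_itv.
  apply: quadratic_error_negligible.
  - move=> k; rewrite EE -[X in measurable X]setTI.
    exact: (@measurable_coordinate R k measurableT _ mr).
  - by move=> k; rewrite EE (countable_power_coordinate Pp)//; exact: measure_ofE.
  - move=> j k jk; rewrite !EE (countable_power_coordinates2 Pp)// EFinM.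
    by congr (_ * _)%E; exact: measure_ofE.
exact: (negligible_setC_forall nA).
Qed.

End estimation.

(** * A default distribution function, and the estimate *)

Section cauchy.
Variable R : realType.

Definition cauchy_cdf (x : R) : R := atan x / pi + 1 / 2.

Let cauchy_cdf_lt : {homo cauchy_cdf : x y / x < y}.
Proof.
by move=> x y xy; rewrite ltrD2r ltr_pM2r ?invr_gt0 ?pi_gt0// lt_atan.
Qed.

Let cauchy_cdf_continuous : continuous cauchy_cdf.
Proof.
move=> x; apply: cvgD; last exact: cvg_cst.
by apply: cvgM; [exact: continuous_atan|exact: cvg_cst].
Qed.

Let cauchy_cdfy : cauchy_cdf @ +oo --> (1 : R).
Proof.
have pi0 : (pi : R) != 0 by rewrite gt_eqF ?pi_gt0.
have half (c : R) : c != 0 -> c / 2 / c + 1 / 2 = 1 by move=> c0; field.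
rewrite -(half pi pi0).
apply: cvgD; last exact: cvg_cst.
by apply: cvgM; [exact: cvgy_atan|exact: cvg_cst].
Qed.

(** The limit at -oo comes from the symmetry of the Cauchy law. *)
Let cauchy_cdfNy : cauchy_cdf @ -oo --> (0 : R).
Proof.
apply/cvgNy_compNP.
have -> : cauchy_cdf \o -%R = fun x => 1 - cauchy_cdf x.
  by apply/funext => x; rewrite /cauchy_cdf/= atanN; lra.
have h : (1 - cauchy_cdf x : R) @[x --> +oo] --> (1 - 1 : R).
  by apply: cvgB; [exact: cvg_cst|exact: cauchy_cdfy].
by rewrite subrr in h.
Qed.

HB.instance Definition _ := isCumulative.Build R _ R cauchy_cdf
  (ltW_homo cauchy_cdf_lt) (right_continuousW cauchy_cdf_continuous).

HB.instance Definition _ :=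
  isCumulativeBounded.Build R 0 1 cauchy_cdf cauchy_cdfNy cauchy_cdfy.

Definition cauchy_distribution : sc_distribution R :=
  exist _ (cauchy_cdf : cumulativeBounded 0 1)
    (conj cauchy_cdf_lt cauchy_cdf_continuous).

End cauchy.

Theorem corollary4p15 (R : realType) :
  exists T : seqR R -> sc_distribution R,
    well_founded_estimate
      (fun F : sc_distribution R => countable_power (measure_of F)) T.
Proof.
apply: (@well_founded_estimate_of_separation _ _ _ _ _ (cauchy_distribution R)
  (@follows R)).
- exact: follows_inj.
- exact: follows_negligible.
Qed.
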